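(* Let $n\ge 1$ and $d\in\mathbb{N}$. There exists a constant $C(n,d)>0$, depending only on $n$ and $d$, such that for every polynomial $f\in\mathbb{R}[x_1,\dots,x_n]$ of degree $d$, $$f_{\min}-f_{((r+1)n)}\le \frac{C(n,d)}{r^2}\cdot (f_{\max}-f_{\min})\quad\text{ for all integers } r\ge 1 \text{ with } r\ge \pi d\sqrt{2n}.$$ Furthermore, the constant $C(n,d)$ may be chosen such that it either depends polynomially on $n$ for fixed $d$, or depends polynomially on $d$ for fixed $n$. Namely, for $d\ge 1$, it can be chosen with $C(n,d)\le 2\pi^2d^2\,n\,2^{d/2}(n+1)^d$, respectively with $C(n,d)\le 2\pi^2d^2\,n\,2^{n/2}(d+1)^n$.
   Context: $\mathbb{N}=\{0,1,2,\dots\}$, $[n]=\{1,\dots,n\}$. $\mathrm{B}^n=[-1,1]^n\subseteq\mathbb{R}^n$. For a polynomial $f$, $f_{\min}$ and $f_{\max}$ denote its minimum and maximum over $\mathrm{B}^n$. $\Sigma[\mathbf{x}]$ is the set of sums of squares of polynomials in $\mathbb{R}[\mathbf{x}]=\mathbb{R}[x_1,\dots,x_n]$. Set $g_i(\mathbf{x})=1-x_i^2$ for $i\in[n]$ and $g_J=\prod_{j\in J}g_j$ for $J\subseteq[n]$ (with $g_\emptyset=1$). The preordering truncated at degree $r$ is $$Q(\mathrm{B}^n)_r=\Big\{\sum_{J\subseteq[n]}\sigma_Jg_J:\ \sigma_J\in\Sigma[\mathbf{x}],\ \deg(\sigma_Jg_J)\le r\Big\}$$ (each individual summand has degree at most $r$).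 The lower bound is $f_{(r)}=\max\{\lambda\in\mathbb{R}: f-\lambda\in Q(\mathrm{B}^n)_r\}$; the maximum is attained if the program is feasible, and $f_{(r)}=-\infty$ if it is infeasible. *)

(* Defs.v *)
(* MathComp world: multinomials polynomials over a MathComp-Analysis
   [realType]. *)
From mathcomp Require Import all_boot all_order all_algebra.
From mathcomp Require Import mpoly.
From mathcomp Require Import classical_sets reals ereal exp trigo.

Set Implicit Arguments.
Unset Strict Implicit.
Unset Printing Implicit Defensive.

Import Order.TTheory GRing.Theory Num.Theory.
Local Open Scope ring_scope.
Local Open Scope classical_set_scope.

Definition box (R : realType) (n : nat) : set ('I_n -> R) :=
  [set x | forall i, -1 <= x i <= 1].
Arguments box R n : clear implicits.

(* The box is compact and nonempty, so the infimum and the supremum of the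
   values of [f] on it are its minimum and maximum there. *)
Definition fmin (R : realType) (n : nat) (f : {mpoly R[n]}) : R :=
  inf [set f.@[x] | x in box R n].

Definition fmax (R : realType) (n : nat) (f : {mpoly R[n]}) : R :=
  sup [set f.@[x] | x in box R n].

(* [msize] is the total degree plus one, and 0 on the zero polynomial, to which
   the predecessor therefore gives degree 0. *)
Definition mdegree (R : realType) (n : nat) (p : {mpoly R[n]}) : nat :=
  (msize p).-1.

Definition sos (R : realType) (n : nat) : set {mpoly R[n]} :=
  [set p | exists s : seq {mpoly R[n]}, p = \sum_(q <- s) q ^+ 2].
Arguments sos R n : clear implicits.

Definition gbox (R : realType) (n : nat) (J : {set 'I_n}) : {mpoly R[n]} :=
  \prod_(j in J) (1 - 'X_j ^+ 2).

Definition preordering (R : realType) (n r : nat) : set {mpoly R[n]} :=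
  [set p | exists sigma : {set 'I_n} -> {mpoly R[n]},
     [/\ forall J, sos R n (sigma J),
         forall J, (mdegree (sigma J * gbox R J) <= r)%N
       & p = \sum_(J : {set 'I_n}) sigma J * gbox R J]].
Arguments preordering R n r : clear implicits.

(* The supremum is taken in the extended reals, so that it is -oo when no
   [lambda] is feasible. *)
Definition lower_bound (R : realType) (n : nat) (f : {mpoly R[n]}) (r : nat) :
    \bar R :=
  ereal_sup
    [set lambda%:E | lambda in [set l : R | preordering R n r (f - l%:MP)]].

Definition rate_constant (R : realType) (n d : nat) (C : R) : Prop :=
  0 < C /\
  forall f : {mpoly R[n]}, mdegree f = d ->
  forall r : nat, (1 <= r)%N -> pi * d%:R * Num.sqrt (2 * n%:R) <= r%:R :> R ->
    ((fmin f)%:E - lower_bound f ((r + 1) * n)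
       <= (C / r%:R ^+ 2 * (fmax f - fmin f))%:E)%E.

(* Main.v *)
Require Import Defs.
From mathcomp Require Import all_boot all_order all_algebra.
From mathcomp Require Import mpoly.
From mathcomp Require Import classical_sets reals ereal exp trigo.
From mathcomp Require Import ring lra zify.
From mathcomp Require Import normedtype.
From mathcomp Require subspace_topology derive.

Set Implicit Arguments.
Unset Strict Implicit.
Unset Printing Implicit Defensive.

Import Order.TTheory GRing.Theory Num.Theory numFieldNormedType.Exports.
Local Open Scope ring_scope.

(** The certificate comes from smoothing with a nonnegative polynomial kernel
    that almost preserves polynomials of low degree.

    In one variable, put x = cos s. For an even trigonometric polynomial q of
    degree m, the kernel (q(s + t)^2 + q(s - t)^2) / 2 is, for fixed t, a
    polynomial of degree 2m in x of the explicit form A^2 + (1 - x^2) B^2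
    ([trigpoly_shift]). Summing it over equally spaced t against cos (k t)
    gives a multiple of cos (k s): the Chebyshev polynomials are eigenvectors
    of the smoothing operator ([jackson_kernel_eigen]). Taking for q the
    Jackson choice, the Christoffel-Darboux kernel based at the largest zero
    of T_{m+1}, the normalised eigenvalues satisfy 1 - lambda_k <= (k pi / (2m
    + 2))^2 / 2 ([one_sub_jackson_eig_le]). Sums over a sufficiently fine grid
    take the place of integrals: they are exact on the polynomials involved.

    In n variables one takes products. Expanding the product over i of A_i^2 +
    (1 - x_i^2) B_i^2 shows that the product operator maps a polynomial that
    is nonnegative on the box into the preordering of degree 2mn
    ([jackson_preordering]), and it multiplies the Chebyshev product of
    exponent k by Lambda_k, the product of the lambda_{k_i}.

    Let now f have degree d, let m be r / 2 rounded up, let delta be fmax -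
    fmin, and expand f - fmin as the sum of the c_k T_k. Dividing each c_k by
    Lambda_k moves the polynomial on the box by at most eps = sum_k |c_k| (1 /
    Lambda_k - 1), so the result plus eps is nonnegative there; applying the
    operator to it gives back f - fmin + eps, which is thus in the
    preordering. Hence fmin - eps is feasible. Finally |c_k| <= 2^(w/2) delta,
    where w is the number of nonzero entries of k, by Bessel's inequality on
    the grid ([cheb_coef_le]); 1 / Lambda_k - 1 is at most pi^2 d^2 / r^2
    ([jackson_eigX_bounds]); and the number of exponents of degree at most d
    is bounded both by (n + 1)^d and by (d + 1)^n. The two families of
    constants correspond to these two counts, together with w <= min (n, d). *)

(** * Chebyshev polynomials and trigonometric inequalities *)

(** Chebyshev polynomials are evaluated in an arbitrary commutative ring, so
    that one definition serves for the polynomials in 'X_i and for their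
    values. *)
Fixpoint chebT (A : comNzRingType) (x : A) (k : nat) : A :=
  if k is k1.+1 then
    if k1 is k2.+1 then 2 * x * chebT x k1 - chebT x k2 else x
  else 1.

(** Chebyshev polynomials of the second kind with the index shifted by one:
    [chebU x k] is U_{k-1}(x), so that sin (k t) = sin t * [chebU (cos t) k]. *)
Fixpoint chebU (A : comNzRingType) (x : A) (k : nat) : A :=
  if k is k1.+1 then
    if k1 is k2.+1 then 2 * x * chebU x k1 - chebU x k2 else 1
  else 0.

Lemma chebT_rec (A : comNzRingType) (x : A) k :
  chebT x k.+2 = 2 * x * chebT x k.+1 - chebT x k.
Proof. by []. Qed.

Lemma chebU_rec (A : comNzRingType) (x : A) k :
  chebU x k.+2 = 2 * x * chebU x k.+1 - chebU x k.
Proof. by []. Qed.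

Lemma nat_ind2 (P : nat -> Prop) :
  P 0%N -> P 1%N -> (forall k, P k -> P k.+1 -> P k.+2) -> forall k, P k.
Proof.
move=> P0 P1 PS k; suff [] : P k /\ P k.+1 by [].
by elim: k => [//|k [Pk PkS]]; split=> //; apply: PS.
Qed.

Lemma rmorph_chebT (A B : comNzRingType) (f : {rmorphism A -> B}) x k :
  f (chebT x k) = chebT (f x) k.
Proof.
elim/nat_ind2: k => [||k IH0 IH1]; rewrite ?rmorph1 //.
by rewrite !chebT_rec rmorphB !rmorphM rmorph_nat IH0 IH1.
Qed.

Lemma rmorph_chebU (A B : comNzRingType) (f : {rmorphism A -> B}) x k :
  f (chebU x k) = chebU (f x) k.
Proof.
elim/nat_ind2: k => [||k IH0 IH1]; rewrite ?rmorph1 ?rmorph0 //.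
by rewrite !chebU_rec rmorphB !rmorphM rmorph_nat IH0 IH1.
Qed.

Lemma chebT_cos (R : realType) (t : R) k : chebT (cos t) k = cos (k%:R * t).
Proof.
elim/nat_ind2: k => [||k IH0 IH1]; rewrite ?mul0r ?cos0 ?mul1r //.
rewrite chebT_rec IH0 IH1.
have -> : k.+2%:R * t = k.+1%:R * t + t by rewrite -[k.+2]addn1 natrD; ring.
have -> : k%:R * t = k.+1%:R * t - t by rewrite -[k.+1]addn1 natrD; ring.
rewrite cosB cosD; ring.
Qed.

Lemma chebU_sin (R : realType) (t : R) k :
  sin t * chebU (cos t) k = sin (k%:R * t).
Proof.
elim/nat_ind2: k => [||k IH0 IH1]; rewrite ?mul0r ?sin0 ?mulr0 ?mul1r ?mulr1 //.
rewrite chebU_rec mulrBr IH0 mulrCA IH1.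
have -> : k.+2%:R * t = k.+1%:R * t + t by rewrite -[k.+2]addn1 natrD; ring.
have -> : k%:R * t = k.+1%:R * t - t by rewrite -[k.+1]addn1 natrD; ring.
rewrite sinB sinD; ring.
Qed.

Lemma cosM (R : realType) (a b : R) :
  cos a * cos b = (cos (a + b) + cos (a - b)) / 2.
Proof. by rewrite cosD cosB; field. Qed.

Lemma cos_double (R : realType) (t : R) : cos (2 * t) = 1 - 2 * sin t ^+ 2.
Proof. rewrite mulr_natl cos_mulr2n cos2sin2; ring. Qed.

Lemma norm_sin_le (R : realType) (x : R) : `|sin x| <= `|x|.
Proof.
wlog x0 : x / 0 <= x => [h|].
  case: (leP 0 x) => [|/ltW x0]; first exact: h.
  by rewrite -normrN -sinN -(normrN x); apply: h; rewrite oppr_ge0.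
have [|c _] := @derive.MVT_segment R sin cos _ _ x0.
  apply: subspace_topology.continuous_subspaceT; exact: continuous_sin.
by rewrite sin0 !subr0 => ->; rewrite normrM ler_piMl // cos_max.
Qed.

Lemma one_sub_cos_le (R : realType) (x : R) : 1 - cos x <= x ^+ 2 / 2.
Proof.
have -> : x = 2 * (x / 2) by field.
rewrite cos_double; have := norm_sin_le (x / 2).
rewrite -(ler_pXn2r (isT : (0 < 2)%N)) ?nnegrE // !real_normK ?num_real // => h.
by move: h; set s := sin _; lra.
Qed.

(** Induction by the addition formula, where both cosines are at most 1 in
    absolute value. *)
Lemma norm_sin_natmul_le (R : realType) (x : R) k :
  `|sin (k%:R * x)| <= k%:R * `|sin x|.
Proof.
elim: k => [|k IH]; first by rewrite !mul0r sin0 normr0.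
rewrite -[k.+1]addn1 natrD !mulrDl !mul1r sinD.
apply: le_trans (ler_normD _ _) _; rewrite !normrM.
by rewrite lerD // ?(le_trans _ IH) // ?ler_piMr ?ler_piMl // cos_max.
Qed.

(** Since 1 - cos (2 x) = 2 (sin x)^2, this is the square of the preceding
    inequality at t / 2. It reduces every eigenvalue estimate to the case k =
    1. *)
Lemma one_sub_cos_natmul_le (R : realType) (t : R) k :
  1 - cos (k%:R * t) <= k%:R ^+ 2 * (1 - cos t).
Proof.
have -> : t = 2 * (t / 2) by field.
rewrite mulrCA !cos_double; have := norm_sin_natmul_le (t / 2) k.
rewrite -(ler_pXn2r (isT : (0 < 2)%N)) ?nnegrE ?mulr_ge0 //.
rewrite exprMn !real_normK ?num_real //.
by move: (sin _) (sin _) => u v h; lra.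
Qed.

(** * Equally spaced angles *)

Definition node (R : realType) (M j : nat) : R := 2 * pi * j%:R / M%:R.
Arguments node R M j : clear implicits.

(** Multiplying by 2 sin b, where b = l pi / M, makes the sum telescope to sin
    (2 pi l - b) + sin b; the bounds on l ensure sin b <> 0. *)
Lemma sum_cos_node (R : realType) M l : (0 < l < M)%N ->
  \sum_(j < M) cos (l%:R * node R M j) = 0.
Proof.
case/andP=> l0 lM; have M0 : 0 < M%:R :> R by rewrite ltr0n (leq_trans _ lM).
pose b : R := l%:R * pi / M%:R.
have b0 : 0 < b by rewrite divr_gt0 // mulr_gt0 ?pi_gt0 ?ltr0n.
have b1 : b < pi by rewrite ltr_pdivrMr // mulrC ltr_pM2l ?pi_gt0 // ltr_nat.
have sb : 2 * sin b != 0.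
  by rewrite mulf_neq0 ?pnatr_eq0 // gt_eqF // sin_gt0_pi // b0 b1.
apply: (mulfI sb); rewrite mulr0 mulr_sumr.
pose f j : R := sin (2 * j%:R * b - b).
rewrite (eq_bigr (fun j : 'I_M => f j.+1 - f j)); last first.
  move=> j _; rewrite /f.
  have -> : l%:R * node R M j = 2 * j%:R * b.
    by rewrite /node /b; field; rewrite gt_eqF.
  have -> : 2 * j.+1%:R * b - b = 2 * j%:R * b + b.
    by rewrite -[j.+1]addn1 natrD; ring.
  by rewrite sinB sinD; ring.
rewrite -(big_mkord xpredT (fun j => f j.+1 - f j)) telescope_sumr // /f.
have -> : 2 * M%:R * b - b = - b + pi *+ 2 *+ l.
  by rewrite -mulrnA -[pi *+ _]mulr_natr natrM /b; field; rewrite gt_eqF.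
by rewrite (periodicn (@sinD2pi R)) mulr0 mul0r sub0r subrr.
Qed.
(** One of the two truncated differences vanishes, so k - l + (l - k) is the
    distance between k and l. *)
Lemma cosM_nat (R : realType) k l (t : R) :
  cos (k%:R * t) * cos (l%:R * t)
    = (cos ((k + l)%:R * t) + cos ((k - l + (l - k))%:R * t)) / 2.
Proof.
wlog lk : k l / (l <= k)%N => [h|].
  case: (leqP l k) => [|/ltnW] kl; first exact: h.
  by rewrite mulrC h // [(l + k)%N]addnC [(l - k + _)%N]addnC.
have -> : (k - l + (l - k) = k - l)%N by lia.
rewrite cosM natrD natrB //.
by congr ((cos _ + cos _) / 2); ring.
Qed.

Lemma sum_cosM_node (R : realType) M k l : k != l -> (k + l < M)%N ->
  \sum_(j < M) cos (k%:R * node R M j) * cos (l%:R * node R M j) = 0.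
Proof.
move=> kl klM; under eq_bigr do rewrite cosM_nat.
rewrite -mulr_suml big_split /= !sum_cos_node ?addr0 ?mul0r //; lia.
Qed.

Lemma sum_cos_sqr_node (R : realType) M k : (k + k < M)%N ->
  \sum_(j < M) cos (k%:R * node R M j) ^+ 2 = M%:R / 2 ^+ (k != 0%N).
Proof.
case: k => [|k] kM.
  under eq_bigr do rewrite mul0r cos0 expr1n.
  by rewrite sumr_const card_ord divr1.
under eq_bigr do rewrite expr2 cosM_nat subnn mul0r cos0.
by rewrite -mulr_suml big_split /= sum_cos_node // add0r sumr_const card_ord.
Qed.

(** * The convolution kernel *)

Definition trigpoly (R : realType) (b : nat -> R) m (t : R) : R :=
  \sum_(l < m.+1) b l * cos (l%:R * t).

(** What convolution of an even h with cos (k t) gives on the circle, with the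
    integrals replaced by sums over the nodes. It is linear in h, so for
    trigonometric polynomials it need only be checked on cosines. *)
Definition reproduces (R : realType) M k (s : R) (h : R -> R) : Prop :=
  \sum_(j < M) (h (s + node R M j) + h (s - node R M j)) / 2
               * cos (k%:R * node R M j)
  = cos (k%:R * s) * \sum_(j < M) h (node R M j) * cos (k%:R * node R M j).

Lemma reproduces_cos (R : realType) M k (s : R) l : (k + l < M)%N ->
  reproduces M k s (fun t => cos (l%:R * t)).
Proof.
move=> klM; rewrite /reproduces.
under eq_bigr do rewrite mulrDr mulrBr -cosM -mulrA.
rewrite -mulr_sumr; have [->//|lk] := eqVneq l k.
by rewrite sum_cosM_node ?mulr0 // addnC.
Qed.

Lemma eq_reproduces (R : realType) M k (s : R) (h h' : R -> R) :
  h =1 h' -> reproduces M k s h -> reproduces M k s h'.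
Proof.
rewrite /reproduces => hh'.
under eq_bigr do rewrite !hh'.
by under [in X in _ = X -> _]eq_bigr do rewrite hh'.
Qed.

Lemma reproducesD (R : realType) M k (s : R) (h h' : R -> R) :
  reproduces M k s h -> reproduces M k s h' ->
  reproduces M k s (fun t => h t + h' t).
Proof.
rewrite /reproduces => e e'.
under [in RHS]eq_bigr do rewrite mulrDl.
rewrite big_split mulrDr /= -e -e' -big_split /=.
by apply: eq_bigr => j _; field.
Qed.

Lemma reproducesZ (R : realType) M k (s : R) a (h : R -> R) :
  reproduces M k s h -> reproduces M k s (fun t => a * h t).
Proof.
rewrite /reproduces => e.
under [in RHS]eq_bigr do rewrite -mulrA.
rewrite -mulr_sumr mulrCA -e mulr_sumr.
by apply: eq_bigr => j _; field.
Qed.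

Lemma reproduces_sum (R : realType) M k (s : R) (I : Type) (r : seq I)
    (F : I -> R -> R) :
  (forall i, reproduces M k s (F i)) ->
  reproduces M k s (fun t => \sum_(i <- r) F i t).
Proof.
move=> hF; elim: r => [|i r IH].
  rewrite /reproduces !big1 ?mulr0 // => j _; rewrite !big_nil; ring.
apply: (eq_reproduces _ (reproducesD (hF i) IH)) => t.
by rewrite big_cons.
Qed.

(** The square is a combination of cosines of frequency at most 2m, low enough
    for [reproduces_cos]. *)
Lemma reproduces_trigpoly_sqr (R : realType) M k (s : R) (b : nat -> R) m :
  (k + m.*2 < M)%N -> reproduces M k s (fun t => trigpoly b m t ^+ 2).
Proof.
move=> kmM.
pose F (p : 'I_m.+1 * 'I_m.+1) t : R :=
  b p.1 * b p.2 / 2 * (cos ((p.1 + p.2)%:R * t)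
                       + cos ((p.1 - p.2 + (p.2 - p.1))%:R * t)).
apply: (@eq_reproduces _ _ _ _ (fun t => \sum_p F p t)) => [t|].
  rewrite expr2 /trigpoly big_distrlr /= pair_big /=.
  by apply: eq_bigr => -[p q] _; rewrite /F /= mulrACA cosM_nat; field.
apply: reproduces_sum => -[[p hp] [q hq]] /=.
by apply: reproducesZ; apply: reproducesD; apply: reproduces_cos => /=; lia.
Qed.

(** With U and V the cosine and sine parts of q(s + t), the two shifts are U -
    V and U + V, whose squares average to U^2 + V^2; and V is sin s times a
    polynomial in cos s. This is the univariate certificate of nonnegativity. *)
Lemma trigpoly_shift (R : realType) (b : nat -> R) m (s t : R) :
  (trigpoly b m (s + t) ^+ 2 + trigpoly b m (s - t) ^+ 2) / 2 =
    (\sum_(l < m.+1) b l * cos (l%:R * t) * chebT (cos s) l) ^+ 2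
    + (1 - cos s ^+ 2)
      * (\sum_(l < m.+1) b l * sin (l%:R * t) * chebU (cos s) l) ^+ 2.
Proof.
rewrite -sin2cos2 -exprMn.
set U := \sum_(l < _) _; set V := sin s * _.
have -> : trigpoly b m (s + t) = U - V.
  rewrite /U /V mulr_sumr -sumrB; apply: eq_bigr => l _.
  by rewrite chebT_cos mulrCA chebU_sin mulrDr cosD; ring.
have -> : trigpoly b m (s - t) = U + V.
  rewrite /U /V mulr_sumr -big_split; apply: eq_bigr => l _ /=.
  by rewrite chebT_cos mulrCA chebU_sin mulrBr cosB; ring.
by field.
Qed.

(** The cosine of this angle is the largest zero of T_{m+1}. *)
Definition jackson_angle (R : realType) m : R := pi / (m.+1).*2%:R.
Arguments jackson_angle R m : clear implicits.

(** The values at that zero of the Chebyshev polynomials, halved at index 0 to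
    account for the norm of T_0. *)
Definition jackson_coef (R : realType) m l : R :=
  if l == 0%N then 1 / 2 else cos (l%:R * jackson_angle R m).
Arguments jackson_coef R m l : clear implicits.

Definition jackson_root (R : realType) m : R -> R :=
  trigpoly (jackson_coef R m) m.

(** By the recurrence, the new term 2 (x - y) T_{m+1}(x) T_{m+1}(y) is the
    difference of two consecutive right-hand sides. *)
Lemma christoffel_darboux (R : realType) m (s t : R) :
  2 * (cos t - cos s) *
    \sum_(l < m.+1) (if l == 0%N :> nat then 1 / 2 else cos (l%:R * s))
                    * cos (l%:R * t)
  = cos (m.+1%:R * t) * cos (m%:R * s) - cos (m%:R * t) * cos (m.+1%:R * s).
Proof.
elim: m => [|m IH].
  by rewrite big_ord1 /= !mul0r !mul1r cos0; field.
rewrite big_ord_recr mulrDr IH /= -!chebT_cos chebT_rec chebT_rec; ring.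
Qed.

(** The second term of the Christoffel-Darboux formula vanishes because
    T_{m+1} is zero at [jackson_angle]. *)
Lemma jackson_root_christoffel (R : realType) m (t : R) :
  2 * (cos t - cos (jackson_angle R m)) * jackson_root m t
  = cos (m.+1%:R * t) * cos (m%:R * jackson_angle R m).
Proof.
have e : m.+1%:R * jackson_angle R m = pi / 2.
  by rewrite /jackson_angle -muln2 natrM invfM mulrCA mulVKf ?pnatr_eq0.
by rewrite /jackson_root /trigpoly christoffel_darboux e cos_pihalf mulr0 subr0.
Qed.

(** Let a be the angle. Up to a constant, (cos t - cos a) q(t) is cos ((m + 1)
    t), which is orthogonal to q; hence q^2 has mean cosine exactly cos a. *)
Lemma sum_jackson_root_sqr_cos (R : realType) M m : (m.*2.+1 < M)%N ->
  \sum_(j < M) jackson_root m (node R M j) ^+ 2 * cos (node R M j)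
  = cos (jackson_angle R m) * \sum_(j < M) jackson_root m (node R M j) ^+ 2.
Proof.
move=> mM; apply/eqP; rewrite -subr_eq0 mulr_sumr -sumrB.
have two : (2 : R) != 0 by rewrite pnatr_eq0.
rewrite -(mulrI_eq0 _ (mulfI two)) mulr_sumr.
rewrite (eq_bigr (fun j : 'I_M => cos (m%:R * jackson_angle R m) *
   (jackson_root m (node R M j) * cos (m.+1%:R * node R M j)))); last first.
  move=> j _; rewrite [RHS]mulrCA [_ * cos (m.+1%:R * _)]mulrC.
  rewrite -jackson_root_christoffel.
  ring.
rewrite -mulr_sumr /jackson_root /trigpoly.
under eq_bigr do rewrite mulr_suml.
rewrite exchange_big big1 ?mulr0 // => -[l hl] _ /=.
under eq_bigr do rewrite -mulrA.
rewrite -mulr_sumr sum_cosM_node ?mulr0 //; lia.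
Qed.

Definition jackson_mass (R : realType) M m : R :=
  \sum_(j < M) jackson_root m (node R M j) ^+ 2.
Arguments jackson_mass R M m : clear implicits.

(** The node 0 alone contributes a positive term, since all coefficients of q
    are nonnegative and the first one is 1 / 2. *)
Lemma jackson_mass_gt0 (R : realType) M m : (0 < M)%N -> 0 < jackson_mass R M m.
Proof.
case: M => // M _; rewrite /jackson_mass big_ord_recl.
rewrite ltr_pwDl ?sumr_ge0 // => [|j _]; last exact: sqr_ge0.
rewrite exprn_gt0 // /node mulr0 mul0r /jackson_root /trigpoly big_ord_recl.
rewrite ltr_pwDl //; first by rewrite /jackson_coef /= mulr0 cos0; lra.
apply: sumr_ge0 => l _; rewrite mulr0 cos0 mulr1 /jackson_coef /=.
apply: cos_ge0_pihalf; rewrite /jackson_angle.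
have p0 := pi_gt0 R; apply/andP; split.
  apply: (@le_trans _ _ 0); first by rewrite oppr_le0 divr_ge0 // ltW.
  by rewrite mulr_ge0 // divr_ge0 // ltW.
rewrite mulrCA ler_pM2l // -[_.*2]muln2 natrM invfM mulrA ler_piMl //.
by rewrite ler_pdivrMr ?ltr0n // mul1r ler_nat /bump add1n leqW.
Qed.

Definition jackson_eig (R : realType) M m k : R :=
  (\sum_(j < M) jackson_root m (node R M j) ^+ 2 * cos (k%:R * node R M j))
  / jackson_mass R M m.
Arguments jackson_eig R M m k : clear implicits.

Lemma jackson_eig0 (R : realType) M m : (0 < M)%N -> jackson_eig R M m 0 = 1.
Proof.
move=> M0; rewrite /jackson_eig; under eq_bigr do rewrite mul0r cos0 mulr1.
by rewrite divff // gt_eqF // jackson_mass_gt0.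
Qed.

Lemma one_sub_jackson_eig (R : realType) M m k : (0 < M)%N ->
  1 - jackson_eig R M m k =
  (\sum_(j < M) jackson_root m (node R M j) ^+ 2
                 * (1 - cos (k%:R * node R M j)))
  / jackson_mass R M m.
Proof.
move=> M0; under eq_bigr do rewrite mulrBr mulr1.
by rewrite sumrB mulrBl divff // gt_eqF // jackson_mass_gt0.
Qed.

Lemma jackson_eig_le1 (R : realType) M m k :
  (0 < M)%N -> jackson_eig R M m k <= 1.
Proof.
move=> M0; rewrite -subr_ge0 one_sub_jackson_eig //.
rewrite divr_ge0 ?(ltW (jackson_mass_gt0 _ _ _)) //.
by apply: sumr_ge0 => j _; rewrite mulr_ge0 ?sqr_ge0 // subr_ge0 cos_le1.
Qed.

(** The weight q^2 is nonnegative, so 1 - cos (k t) may be replaced pointwise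
    by k^2 (1 - cos t), whose mean is known exactly. *)
Lemma one_sub_jackson_eig_le (R : realType) M m k : (m.*2.+1 < M)%N ->
  1 - jackson_eig R M m k <= k%:R ^+ 2 * (jackson_angle R m ^+ 2 / 2).
Proof.
move=> mM; have M0 : (0 < M)%N by exact: leq_trans mM.
have J0 := jackson_mass_gt0 R m M0.
rewrite one_sub_jackson_eig // ler_pdivrMr //.
apply: (@le_trans _ _ (k%:R ^+ 2 * \sum_(j < M) jackson_root m (node R M j) ^+ 2
                                  * (1 - cos (node R M j)))).
  rewrite mulr_sumr ler_sum // => j _.
  by rewrite [leRHS]mulrCA ler_wpM2l ?sqr_ge0 // one_sub_cos_natmul_le.
rewrite -[leRHS]mulrA ler_wpM2l ?sqr_ge0 //.
under eq_bigr do rewrite mulrBr mulr1.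
rewrite sumrB sum_jackson_root_sqr_cos // -/(jackson_mass R M m).
rewrite -{1}[jackson_mass R M m]mul1r -mulrBl ler_wpM2r ?(ltW J0) //.
exact: one_sub_cos_le.
Qed.

Lemma jackson_kernel_eigen (R : realType) M m k (s : R) : (k + m.*2 < M)%N ->
  \sum_(j < M) (jackson_root m (s + node R M j) ^+ 2
                + jackson_root m (s - node R M j) ^+ 2) / 2
     / jackson_mass R M m * cos (k%:R * node R M j)
  = jackson_eig R M m k * cos (k%:R * s).
Proof.
move=> kmM; rewrite /jackson_eig [RHS]mulrC mulrA.
rewrite -reproduces_trigpoly_sqr // mulr_suml.
by apply: eq_bigr => j _; rewrite mulrAC.
Qed.
(** * Exponents *)

Definition nvars n (k : 'X_{1..n}) : nat := \sum_(i < n) (k i != 0%N).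

Lemma nvars_le n (k : 'X_{1..n}) : (nvars k <= minn n (mdeg k))%N.
Proof.
rewrite leq_min; apply/andP; split.
  rewrite -[X in (_ <= X)%N]card_ord -sum1_card.
  by apply: leq_sum => i _; apply: leq_b1.
by rewrite mdegE; apply: leq_sum => i _; rewrite -lt0n; case: (k i).
Qed.

Lemma leq_mnm_mdeg n (k : 'X_{1..n}) i : (k i <= mdeg k)%N.
Proof. by rewrite mdegE (bigD1 i) //= leq_addr. Qed.

Lemma sum_sqr_mnm_le n (k : 'X_{1..n}) : (\sum_(i < n) k i ^ 2 <= mdeg k ^ 2)%N.
Proof.
rewrite [X in (_ <= X ^ 2)%N]mdegE -mulnn big_distrl /=.
by apply: leq_sum => i _; rewrite -mulnn leq_mul2l -mdegE leq_mnm_mdeg orbT.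
Qed.

Lemma mnm_neq_ex n (k l : 'X_{1..n}) : k != l -> exists i, k i != l i.
Proof.
move=> kl; apply/existsP; apply: contraNT kl.
rewrite negb_exists => /forallP h.
by apply/eqP/mnmP => i; apply/eqP; have := h i; rewrite negbK.
Qed.

Lemma mnm_predE n (k : 'X_{1..n}) :
  k != 0%MM -> exists i k', k = (U_(i) + k')%MM.
Proof.
move=> /mnm_neq_ex[i]; rewrite mnmE => ki; exists i, (k - U_(i))%MM.
apply/mnmP => j; rewrite mnmDE mnmBE mnm1E.
by case: eqVneq => [<-|_]; [rewrite subnKC // lt0n | rewrite subn0].
Qed.

Lemma card_bmultinom_expn n d : (#|{: 'X_{1..n < d.+1}}| <= d.+1 ^ n)%N.
Proof.
rewrite -[X in (X ^ n)%N](card_ord d.+1) -[n in (_ ^ n)%N]card_ord -card_ffun.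
pose F (k : 'X_{1..n < d.+1}) : {ffun 'I_n -> 'I_d.+1} :=
  [ffun i => inord (k i)].
apply: (@leq_card _ _ F) => k l /ffunP e; apply/val_inj/mnmP => i.
have := e i; rewrite !ffunE => /(congr1 val) /=.
by rewrite !inordK ?ltnS ?(leq_trans (leq_mnm_mdeg _ i)) // -ltnS bmdeg.
Qed.

(** An exponent of degree at most d + 1 is one of degree at most d plus either
    nothing or one of the n unit vectors. *)
Lemma card_bmultinom_expS n d : (#|{: 'X_{1..n < d.+1}}| <= n.+1 ^ d)%N.
Proof.
elim: d => [|d IH].
  rewrite expn0; apply/fintype_le1P => k l; apply/val_inj.
  have z (j : 'X_{1..n < 1}) : j = 0%MM :> 'X_{1..n}.
    by apply/eqP; rewrite -mdeg_eq0 -leqn0 -ltnS bmdeg.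
  by rewrite /= !z.
pose u (o : option 'I_n) : 'X_{1..n} := if o is Some i then U_(i)%MM else 0%MM.
have ud o : (mdeg (u o) <= 1)%N by case: o => [i|]; rewrite /= ?mdeg1 ?mdeg0.
have Fd (p : option 'I_n * 'X_{1..n < d.+1}) : (mdeg (u p.1 + p.2) < d.+2)%N.
  by rewrite mdegD; have := ud p.1; have := bmdeg p.2; lia.
pose F p := BMultinom (Fd p).
apply: (@leq_trans #|codom F|); last first.
  apply: leq_trans (card_size _) _.
  rewrite size_codom card_prod card_option card_ord.
  by rewrite expnS leq_mul2l IH orbT.
apply/subset_leq_card/fintype.subsetP => k _.
have [k0|/mnm_predE[i [k' e]]] := eqVneq (k : 'X_{1..n}) 0%MM.
  have d0 : (mdeg (0%MM : 'X_{1..n}) < d.+1)%N by rewrite mdeg0.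
  apply/codomP; exists (None, BMultinom d0); apply/val_inj => /=.
  by rewrite k0 addm0.
have k'd : (mdeg k' < d.+1)%N.
  by have := bmdeg k; rewrite e mdegD mdeg1 add1n.
by apply/codomP; exists (Some i, BMultinom k'd); apply/val_inj.
Qed.

(** * The Chebyshev basis of multivariate polynomials *)

Definition chebX (R : realType) n (k : 'X_{1..n}) : {mpoly R[n]} :=
  \prod_(i < n) chebT ('X_i : {mpoly R[n]}) (k i).
Arguments chebX R [n] k.

Definition cheb_sum (R : realType) n d (c : 'X_{1..n} -> R) : {mpoly R[n]} :=
  \sum_(k : 'X_{1..n < d.+1}) c k *: chebX R k.

Lemma chebX0 (R : realType) n : chebX R (0%MM : 'X_{1..n}) = 1.
Proof. by rewrite /chebX big1 // => i _; rewrite mnmE. Qed.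

Lemma meval_chebX (R : realType) n (x : 'I_n -> R) (k : 'X_{1..n}) :
  (chebX R k).@[x] = \prod_(i < n) chebT (x i) (k i).
Proof.
rewrite rmorph_prod; apply: eq_bigr => i _.
by rewrite (rmorph_chebT (meval x)) /= mevalXU.
Qed.

Lemma meval_chebX_cos (R : realType) n (t : 'I_n -> R) (k : 'X_{1..n}) :
  (chebX R k).@[fun i => cos (t i)] = \prod_(i < n) cos ((k i)%:R * t i).
Proof. by rewrite meval_chebX; under eq_bigr do rewrite chebT_cos. Qed.

Lemma meval_cheb_sum (R : realType) n d (c : 'X_{1..n} -> R) (x : 'I_n -> R) :
  (cheb_sum d c).@[x] = \sum_(k : 'X_{1..n < d.+1}) c k * (chebX R k).@[x].
Proof. by rewrite rmorph_sum; apply: eq_bigr => k _; rewrite /= mevalZ. Qed.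

Lemma chebX_splitE (R : realType) n (i : 'I_n) (k : 'X_{1..n}) :
  chebX R k = chebT 'X_i (k i) * \prod_(j < n | j != i) chebT 'X_j (k j).
Proof. by rewrite /chebX (bigD1 i). Qed.

Lemma mulX_chebX0 (R : realType) n (i : 'I_n) (k : 'X_{1..n}) :
  k i = 0%N -> 'X_i * chebX R k = chebX R (k + U_(i))%MM.
Proof.
move=> ki; rewrite !(chebX_splitE _ i) mnmDE mnm1E eqxx ki mul1r.
congr (_ * _); apply: eq_bigr => j ji.
by rewrite mnmDE mnm1E eq_sym (negbTE ji) addn0.
Qed.

(** The three-term recurrence: x T_{a+1} = (T_{a+2} + T_a) / 2 in the variable
    i. *)
Lemma mulX_chebX (R : realType) n (i : 'I_n) (k : 'X_{1..n}) :
  (0 < k i)%N ->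
  'X_i * chebX R k
  = 2^-1 *: chebX R (k + U_(i))%MM + 2^-1 *: chebX R (k - U_(i))%MM.
Proof.
move=> ki; rewrite !(chebX_splitE _ i) mnmDE mnmBE mnm1E eqxx.
set P := \prod_(j < n | j != i) _.
have e (k' : 'X_{1..n}) : (forall j, j != i -> k' j = k j) ->
    \prod_(j < n | j != i) chebT ('X_j : {mpoly R[n]}) (k' j) = P.
  by move=> h; apply: eq_bigr => j ji; rewrite h.
rewrite !e => [|j ji|j ji]; last 2 first.
- by rewrite mnmBE mnm1E eq_sym (negbTE ji) subn0.
- by rewrite mnmDE mnm1E eq_sym (negbTE ji) addn0.
case: (k i) ki => // a _; rewrite addn1 subn1 /= -/(chebT _ a.+1).
rewrite -scalerDr -mulrDl subrK -!mulrA mulr_natl.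
by rewrite -[X in _ *: X]scaler_nat scalerA mulVf ?pnatr_eq0 // scale1r.
Qed.

Definition chebspan (R : realType) n d (p : {mpoly R[n]}) : Prop :=
  exists c, p = cheb_sum d c.

Lemma chebspan_chebX (R : realType) n d (k : 'X_{1..n}) :
  (mdeg k <= d)%N -> chebspan d (chebX R k).
Proof.
move=> kd; exists (fun l => (l == k)%:R).
rewrite /cheb_sum (bigD1 (BMultinom (kd : mdeg k < d.+1)%N)) //= eqxx scale1r.
rewrite big1 ?addr0 // => l; rewrite bmeqP /= => /negbTE ->.
by rewrite scale0r.
Qed.

Lemma chebspan0 (R : realType) n d : chebspan d (0 : {mpoly R[n]}).
Proof.
by exists (fun=> 0); rewrite /cheb_sum big1 // => k _; rewrite scale0r.
Qed.

Lemma chebspanD (R : realType) n d (p q : {mpoly R[n]}) :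
  chebspan d p -> chebspan d q -> chebspan d (p + q).
Proof.
move=> [c ->] [c' ->]; exists (fun k => c k + c' k).
by rewrite /cheb_sum -big_split; apply: eq_bigr => k _; rewrite scalerDl.
Qed.

Lemma chebspanZ (R : realType) n d a (p : {mpoly R[n]}) :
  chebspan d p -> chebspan d (a *: p).
Proof.
move=> [c ->]; exists (fun k => a * c k).
by rewrite /cheb_sum scaler_sumr; apply: eq_bigr => k _; rewrite scalerA.
Qed.

Lemma chebspan_sum (R : realType) n d (I : Type) (r : seq I) (P : pred I)
    (F : I -> {mpoly R[n]}) :
  (forall i, P i -> chebspan d (F i)) -> chebspan d (\sum_(i <- r | P i) F i).
Proof.
by apply: big_ind; [apply: chebspan0|apply: chebspanD].
Qed.

Lemma chebspan_mulX (R : realType) n d (i : 'I_n) (p : {mpoly R[n]}) :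
  chebspan d p -> chebspan d.+1 ('X_i * p).
Proof.
move=> [c ->]; rewrite mulr_sumr; apply: chebspan_sum => k _.
rewrite -scalerAr; apply: chebspanZ.
have kd := bmdeg k; have [k0|ki] := posnP (k i).
  by rewrite mulX_chebX0 //; apply: chebspan_chebX; rewrite mdegD mdeg1 addn1.
rewrite mulX_chebX //; apply: chebspanD; apply: chebspanZ;
  apply: chebspan_chebX.
  by rewrite mdegD mdeg1 addn1.
exact: leq_trans (mdegB _ _) (ltnW kd).
Qed.

Lemma chebspan_mpolyX (R : realType) n d (k : 'X_{1..n}) :
  (mdeg k <= d)%N -> chebspan d ('X_[k] : {mpoly R[n]}).
Proof.
elim: d k => [|d IH] k; have [->|/mnm_predE[i [k' ->]]] := eqVneq k 0%MM.
- by rewrite mpolyX0 -chebX0; apply: chebspan_chebX.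
- by rewrite mdegD mdeg1.
- by rewrite mpolyX0 -chebX0; apply: chebspan_chebX.
rewrite mdegD mdeg1 add1n ltnS mpolyXD => k'd.
by apply: chebspan_mulX; apply: IH.
Qed.

Lemma chebspan_msize (R : realType) n d (p : {mpoly R[n]}) :
  (msize p <= d.+1)%N -> chebspan d p.
Proof.
move=> pd; rewrite [p]mpolyE big_seq; apply: chebspan_sum => k kp.
apply: chebspanZ; apply: chebspan_mpolyX.
by rewrite -ltnS (leq_trans (msize_mdeg_lt kp)).
Qed.

(** * Bessel's inequality on a grid *)

Definition gridpt (R : realType) n M (phi : {ffun 'I_n -> 'I_M}) : 'I_n -> R :=
  fun i => cos (node R M (phi i)).
Arguments gridpt R [n M] phi.

Lemma gridpt_box (R : realType) n M (phi : {ffun 'I_n -> 'I_M}) :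
  box R n (gridpt R phi).
Proof. by move=> i; rewrite cos_geN1 cos_le1. Qed.

(** The sum over the grid factors into univariate sums, each of which is
    orthogonality of cosines. *)
Lemma grid_chebX_mul (R : realType) n M d (k l : 'X_{1..n}) :
  (mdeg k <= d)%N -> (mdeg l <= d)%N -> (d.*2 < M)%N ->
  \sum_(phi : {ffun 'I_n -> 'I_M})
     (chebX R k).@[gridpt R phi] * (chebX R l).@[gridpt R phi]
  = (k == l)%:R * (M%:R ^+ n / 2 ^+ nvars k).
Proof.
move=> kd ld dM.
pose F (i : 'I_n) (j : 'I_M) : R :=
  cos ((k i)%:R * node R M j) * cos ((l i)%:R * node R M j).
transitivity (\prod_i \sum_j F i j).
  rewrite bigA_distr_bigA; apply: eq_bigr => phi _ /=.
  by rewrite !meval_chebX_cos -big_split.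
have klM i : (k i + l i < M)%N.
  by have := leq_mnm_mdeg k i; have := leq_mnm_mdeg l i; lia.
have [e|kl] := eqVneq k l.
  rewrite mul1r /nvars expr_sum -prodfV -[n in M%:R ^+ n]card_ord -prodr_const.
  rewrite -big_split /=; apply: eq_bigr => i _; rewrite /F -e.
  by rewrite -sum_cos_sqr_node; [|rewrite {2}e].
have [i ki] := mnm_neq_ex kl.
by rewrite mul0r (bigD1 i) //= /F sum_cosM_node ?mul0r.
Qed.

Lemma grid_cheb_sum (R : realType) n M d (c : 'X_{1..n} -> R)
    (k : 'X_{1..n < d.+1}) : (d.*2 < M)%N ->
  \sum_(phi : {ffun 'I_n -> 'I_M})
     (cheb_sum d c).@[gridpt R phi] * (chebX R k).@[gridpt R phi]
  = c k * (M%:R ^+ n / 2 ^+ nvars k).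
Proof.
move=> dM; have bd (l : 'X_{1..n < d.+1}) : (mdeg l <= d)%N := bmdeg l.
under eq_bigr do rewrite meval_cheb_sum mulr_suml.
rewrite exchange_big /= (bigD1 k) //= [X in _ + X]big1 ?addr0 => [|l lk].
  under eq_bigr do rewrite -mulrA.
  by rewrite -mulr_sumr (@grid_chebX_mul _ _ _ d) // eqxx mul1r.
under eq_bigr do rewrite -mulrA.
rewrite -mulr_sumr (@grid_chebX_mul _ _ _ d) //.
by move: lk; rewrite bmeqP => /negbTE ->; rewrite mul0r mulr0.
Qed.

(** Bessel's inequality: the grid mean of (f - c_k T_k)^2 is nonnegative, and
    T_k has mean square 2^-w, with w = [nvars k]. *)
Lemma cheb_coef_le (R : realType) n d (c : 'X_{1..n} -> R) (delta : R) :
  (forall x, box R n x -> `|(cheb_sum d c).@[x]| <= delta) ->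
  forall k : 'X_{1..n < d.+1}, `|c k| <= Num.sqrt 2 ^+ nvars k * delta.
Proof.
move=> hf k; pose M := d.*2.+1; pose f := cheb_sum d c.
pose T (phi : {ffun 'I_n -> 'I_M}) := (chebX R k).@[gridpt R phi].
pose N : R := M%:R ^+ n.
have N0 : 0 < N by rewrite exprn_gt0 // ltr0n.
have d0 : 0 <= delta.
  by apply: le_trans (hf _ (@gridpt_box R n M [ffun=> ord0])); exact: normr_ge0.
pose w : R := 2 ^+ nvars k; have w0 : 0 < w by rewrite exprn_gt0.
have bessel : 0 <= N * delta ^+ 2 - c k ^+ 2 * (N / w).
  apply: (@le_trans _ _ (\sum_phi (f.@[gridpt R phi] - c k * T phi) ^+ 2)).
    by apply: sumr_ge0 => phi _; apply: sqr_ge0.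
  rewrite (eq_bigr (fun phi => f.@[gridpt R phi] ^+ 2
     + (- 2 * c k) * (f.@[gridpt R phi] * T phi)
     + c k ^+ 2 * (T phi * T phi))); last by move=> phi _; ring.
  rewrite !big_split /= -!mulr_sumr grid_cheb_sum //.
  rewrite (@grid_chebX_mul _ _ _ d) ?(bmdeg k : mdeg k <= d)%N // eqxx mul1r.
  rewrite -/N -/w.
  have : \sum_(phi : {ffun 'I_n -> 'I_M}) f.@[gridpt R phi] ^+ 2
         <= N * delta ^+ 2.
    apply: (@le_trans _ _ (\sum_(phi : {ffun 'I_n -> 'I_M}) delta ^+ 2)).
      apply: ler_sum => phi _.
      rewrite -real_normK ?num_real // ler_pXn2r ?nnegrE //.
      by apply: hf; apply: gridpt_box.
    by rewrite sumr_const card_ffun !card_ord -mulr_natl natrX.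
  set S := \sum_(_ : _) _; set u := N / w; lra.
rewrite -(ler_pXn2r (isT : (0 < 2)%N)) ?nnegrE //; last first.
  by rewrite mulr_ge0 // exprn_ge0 // sqrtr_ge0.
rewrite real_normK ?num_real // exprMn -exprM mulnC exprM sqr_sqrtr // -/w.
have : c k ^+ 2 * (N / w) = N * (c k ^+ 2 / w) by ring.
move: bessel => /[swap] ->; rewrite -mulrBr pmulr_rge0 // subr_ge0.
by rewrite ler_pdivrMr // mulrC.
Qed.

(** The coefficient bound with delta = 0. It allows polynomial identities to
    be checked at the points (cos s_i) only. *)
Lemma mpoly_box_eq0 (R : realType) n (p : {mpoly R[n]}) :
  (forall x, box R n x -> p.@[x] = 0) -> p = 0.
Proof.
move=> hp; have [c pc] := chebspan_msize (leqSpred (msize p)).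
rewrite pc; apply: big1 => k _; suff -> : c k = 0 by rewrite scale0r.
have h x : box R n x -> `|(cheb_sum (msize p).-1 c).@[x]| <= 0.
  by move=> xb; rewrite -pc hp // normr0.
by have := cheb_coef_le h k; rewrite mulr0 normr_le0 => /eqP.
Qed.
(** * Degree bounds and sums of squares *)

Lemma msize_addl_le (R : realType) n e (p q : {mpoly R[n]}) :
  (msize p <= e)%N -> (msize q <= e)%N -> (msize (p + q) <= e)%N.
Proof. by move=> pe qe; rewrite (leq_trans (msizeD_le _ _)) // geq_max pe. Qed.

Lemma msize_sum_le (R : realType) n e (I : Type) (r : seq I) (P : pred I)
    (F : I -> {mpoly R[n]}) :
  (forall i, P i -> (msize (F i) <= e)%N) ->
  (msize (\sum_(i <- r | P i) F i) <= e)%N.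
Proof.
move=> h; apply: (big_ind (fun p : {mpoly R[n]} => msize p <= e)%N) => //.
  by rewrite msize0.
exact: msize_addl_le.
Qed.

(** [msize] is one more than the degree, hence the shape of the bound; the
    zero polynomial, of [msize] 0, has to be treated apart. *)
Lemma msize_mul_le (R : realType) n a b (p q : {mpoly R[n]}) :
  (msize p <= a.+1)%N -> (msize q <= b.+1)%N -> (msize (p * q) <= (a + b).+1)%N.
Proof.
move=> pa qb; have [->|p0] := eqVneq p 0; first by rewrite mul0r msize0.
have [->|q0] := eqVneq q 0; first by rewrite mulr0 msize0.
by rewrite msizeM // -subn1 leq_subLR add1n -addSn -addnS leq_add.
Qed.

Lemma msize_prod_le (R : realType) n e (F : 'I_n -> {mpoly R[n]}) :
  (forall i, (msize (F i) <= e.+1)%N) -> (msize (\prod_i F i) <= (e * n).+1)%N.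
Proof.
move=> h; rewrite -big_enum -[n in (e * n)%N]size_enum_ord.
elim: (enum _) => [|i r IH]; first by rewrite big_nil msize1.
by rewrite big_cons mulnS; apply: msize_mul_le.
Qed.

Lemma msizeXU (R : realType) n (i : 'I_n) : msize ('X_i : {mpoly R[n]}) = 2%N.
Proof. by rewrite msizeX mdeg1. Qed.

Lemma msize_cheb_step (R : realType) n (i : 'I_n) e (p q : {mpoly R[n]}) :
  (msize p <= e.+1)%N -> (msize q <= e.+2)%N ->
  (msize (2 * 'X_i * p - q) <= e.+2)%N.
Proof.
move=> pe qe; apply: msize_addl_le; last by rewrite msizeN.
rewrite -mulrA mulr_natl -scaler_nat (leq_trans (msizeZ_le _ _)) //.
by rewrite -[e.+2]/(1 + e).+1 msize_mul_le // msizeXU.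
Qed.

Lemma msize_chebT (R : realType) n (i : 'I_n) k :
  (msize (chebT ('X_i : {mpoly R[n]}) k) <= k.+1)%N.
Proof.
elim/nat_ind2: k => [||k IH0 IH1]; rewrite ?msize1 ?msizeXU //.
by rewrite chebT_rec msize_cheb_step // (leq_trans IH0) // ltnW.
Qed.

Lemma msize_chebU (R : realType) n (i : 'I_n) k :
  (msize (chebU ('X_i : {mpoly R[n]}) k) <= k)%N.
Proof.
elim/nat_ind2: k => [||k IH0 IH1]; rewrite ?msize0 ?msize1 //.
by rewrite chebU_rec msize_cheb_step // (leq_trans IH0) // -addn2 leq_addr.
Qed.

(** Nonnegative weights are absorbed into the squares through their square
    roots. *)
Lemma sos_sum_sqr (R : realType) n (I : finType) (a : I -> R)
    (q : I -> {mpoly R[n]}) :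
  (forall i, 0 <= a i) -> sos R n (\sum_i a i *: q i ^+ 2).
Proof.
move=> a0; exists [seq Num.sqrt (a i) *: q i | i <- index_enum I].
by rewrite big_map; apply: eq_bigr => i _; rewrite exprZn sqr_sqrtr.
Qed.

Lemma preordering_le (R : realType) n r r' (p : {mpoly R[n]}) :
  (r <= r')%N -> preordering R n r p -> preordering R n r' p.
Proof.
move=> rr' [sigma [h1 h2 h3]]; exists sigma; split=> // J.
exact: leq_trans (h2 J) rr'.
Qed.

(** * The Jackson operator *)

(** [jackson_cos] and [jackson_sin] are the polynomials of [trigpoly_shift],
    in the variable 'X_i and with t the node of index j. *)
Definition jackson_cos (R : realType) n M m (i : 'I_n) (j : 'I_M) :
    {mpoly R[n]} :=
  \sum_(l < m.+1)
    (jackson_coef R m l * cos (l%:R * node R M j)) *: chebT 'X_i l.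
Arguments jackson_cos R [n M] m i j.

Definition jackson_sin (R : realType) n M m (i : 'I_n) (j : 'I_M) :
    {mpoly R[n]} :=
  \sum_(l < m.+1)
    (jackson_coef R m l * sin (l%:R * node R M j)) *: chebU 'X_i l.
Arguments jackson_sin R [n M] m i j.

Lemma msize_jackson_cos (R : realType) n M m (i : 'I_n) (j : 'I_M) :
  (msize (jackson_cos R m i j) <= m.+1)%N.
Proof.
apply: msize_sum_le => l _; rewrite (leq_trans (msizeZ_le _ _)) //.
exact: leq_trans (msize_chebT R i l) (ltn_ord l).
Qed.

Lemma msize_jackson_sin (R : realType) n M m (i : 'I_n) (j : 'I_M) :
  (msize (jackson_sin R m i j) <= m)%N.
Proof.
apply: msize_sum_le => l _; rewrite (leq_trans (msizeZ_le _ _)) //.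
by rewrite (leq_trans (msize_chebU R i l)) // -ltnS.
Qed.

Lemma meval_kernel (R : realType) n M m (i : 'I_n) (j : 'I_M) (s : 'I_n -> R) :
  (jackson_cos R m i j ^+ 2
   + (1 - 'X_i ^+ 2) * jackson_sin R m i j ^+ 2).@[fun i => cos (s i)]
  = (jackson_root m (s i + node R M j) ^+ 2
     + jackson_root m (s i - node R M j) ^+ 2) / 2.
Proof.
rewrite /jackson_root trigpoly_shift rmorphD rmorphXn rmorphM rmorphB rmorph1.
rewrite !rmorphXn /= mevalXU.
rewrite !rmorph_sum; congr (_ ^+ 2 + _ * _ ^+ 2); apply: eq_bigr => l _.
  by rewrite /= mevalZ (rmorph_chebT (meval _)) /= mevalXU.
by rewrite /= mevalZ (rmorph_chebU (meval _)) /= mevalXU.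
Qed.

(** The eigenvalue Lambda_k of the product operator on [chebX R k]. *)
Definition jackson_eigX (R : realType) n M m (k : 'X_{1..n}) : R :=
  \prod_(i < n) jackson_eig R M m (k i).
Arguments jackson_eigX R [n] M m k.

(** The right-hand side is the product kernel integrated against the grid
    values of the given polynomial. Exchanging the sums and factoring over the
    variables leaves the univariate eigenvalue equation in each of them. *)
Lemma meval_jackson (R : realType) n d m M (c : 'X_{1..n} -> R)
    (s : 'I_n -> R) : (d + m.*2 < M)%N ->
  (cheb_sum d (fun k => jackson_eigX R M m k * c k)).@[fun i => cos (s i)]
  = \sum_(phi : {ffun 'I_n -> 'I_M})
      (cheb_sum d c).@[gridpt R phi] / jackson_mass R M m ^+ n
      * (\prod_i (jackson_cos R m i (phi i) ^+ 2
                  + (1 - 'X_i ^+ 2) * jackson_sin R m i (phi i) ^+ 2))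
          .@[fun i => cos (s i)].
Proof.
move=> dmM; rewrite meval_cheb_sum.
pose K i (j : 'I_M) : R :=
  (jackson_root m (s i + node R M j) ^+ 2
   + jackson_root m (s i - node R M j) ^+ 2) / 2
  / jackson_mass R M m.
transitivity (\sum_(phi : {ffun 'I_n -> 'I_M}) \sum_(k : 'X_{1..n < d.+1})
   c k * \prod_i (K i (phi i) * cos ((k i)%:R * node R M (phi i)))); last first.
  apply: eq_bigr => phi _; rewrite rmorph_prod meval_cheb_sum !mulr_suml.
  apply: eq_bigr => k _; rewrite big_split /= meval_chebX_cos.
  under [X in _ = _ * X]eq_bigr do rewrite meval_kernel.
  rewrite /K big_split /= prodr_const card_ord exprVn; ring.
rewrite exchange_big /=; apply: eq_bigr => k _.
rewrite -mulr_sumr meval_chebX_cos.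
pose F i j := K i j * cos ((k i)%:R * node R M j).
rewrite -(bigA_distr_bigA F) mulrAC mulrC; congr (_ * _).
rewrite /jackson_eigX -big_split; apply: eq_bigr => i _ /=.
rewrite /F /K jackson_kernel_eigen //.
have := leq_mnm_mdeg k i; have := bmdeg k; lia.
Qed.

(** By [meval_jackson] the smoothed polynomial is a combination, with
    nonnegative weights, of products over i of A_i^2 + (1 - x_i^2) B_i^2.
    Expanding such a product over the set J of variables for which the second
    term is chosen gives a square times [gbox R J], of degree at most 2m in
    each variable. *)
Lemma jackson_preordering (R : realType) n d m M (c : 'X_{1..n} -> R) :
  (0 < m)%N -> (d + m.*2 < M)%N ->
  (forall x, box R n x -> 0 <= (cheb_sum d c).@[x]) ->
  preordering R n (m.*2 * n) (cheb_sum d (fun k => jackson_eigX R M m k * c k)).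
Proof.
move=> m0 dmM c0; have M0 : (0 < M)%N by lia.
pose a (phi : {ffun 'I_n -> 'I_M}) :=
  (cheb_sum d c).@[gridpt R phi] / jackson_mass R M m ^+ n.
pose q (J : {set 'I_n}) (phi : {ffun 'I_n -> 'I_M}) : {mpoly R[n]} :=
  \prod_i (if i \in J then jackson_sin R m i (phi i)
           else jackson_cos R m i (phi i)).
pose t (J : {set 'I_n}) (phi : {ffun 'I_n -> 'I_M}) : {mpoly R[n]} :=
  \prod_i (if i \in J then (1 - 'X_i ^+ 2) * jackson_sin R m i (phi i) ^+ 2
           else jackson_cos R m i (phi i) ^+ 2).
have a0 phi : 0 <= a phi.
  rewrite divr_ge0 ?exprn_ge0 ?(ltW (jackson_mass_gt0 _ _ _)) ?c0 //.
  exact: gridpt_box.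
have qt J phi : q J phi ^+ 2 * gbox R J = t J phi.
  rewrite /q /t /gbox [X in _ * X]big_mkcond -prodrXl -big_split /=.
  by apply: eq_bigr => i _; case: ifP => _; rewrite ?mulr1 // mulrC.
have sigE J : (\sum_phi a phi *: q J phi ^+ 2) * gbox R J
              = \sum_phi a phi *: t J phi.
  by rewrite mulr_suml; apply: eq_bigr => phi _; rewrite -scalerAl qt.
exists (fun J => \sum_phi a phi *: q J phi ^+ 2); split.
- by move=> J; apply: sos_sum_sqr.
- move=> J; rewrite sigE /mdegree -subn1 leq_subLR add1n.
  apply: msize_sum_le => phi _; rewrite (leq_trans (msizeZ_le _ _)) //.
  apply: msize_prod_le => i; case: ifP => _.
    (* B has degree m - 1, which makes up for the factor 1 - x^2 *)
    have -> : m.*2 = (2 + (m.-1 + m.-1))%N by lia.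
    apply: msize_mul_le.
      apply: msize_addl_le; rewrite ?msizeN ?msize1 //.
      by apply: (@msize_mul_le _ _ 1 1); rewrite msizeXU.
    apply: msize_mul_le;
      by rewrite (leq_trans (msize_jackson_sin _ _ _ _)) // prednK.
  by rewrite -addnn; apply: msize_mul_le; apply: msize_jackson_cos.
have -> : \sum_(J : {set 'I_n}) (\sum_phi a phi *: q J phi ^+ 2) * gbox R J
          = \sum_phi a phi *: \prod_i (jackson_cos R m i (phi i) ^+ 2
                + (1 - 'X_i ^+ 2) * jackson_sin R m i (phi i) ^+ 2).
  under eq_bigr do rewrite sigE.
  rewrite exchange_big; apply: eq_bigr => phi _ /=.
  rewrite -scaler_sumr; congr (_ *: _).
  under [RHS]eq_bigr do rewrite addrC.
  by rewrite bigA_distr.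
apply/eqP; rewrite -subr_eq0; apply/eqP; apply: mpoly_box_eq0 => x xb.
pose s i := acos (x i).
have xs : x =1 fun i => cos (s i) by move=> i; rewrite /s acosK // in_itv /= xb.
rewrite (meval_eq _ xs) mevalB meval_jackson // rmorph_sum.
apply/eqP; rewrite subr_eq0; apply/eqP; apply: eq_bigr => phi _.
by rewrite /= mevalZ.
Qed.
(** * The error estimate *)

(** The first conclusion is what carries the induction for the second. *)
Lemma one_sub_prod_le (R : realType) (I : Type) (r : seq I) (x : I -> R) :
  (forall i, 0 <= x i <= 1) ->
  0 <= \prod_(i <- r) x i <= 1 /\
  1 - \prod_(i <- r) x i <= \sum_(i <- r) (1 - x i).
Proof.
move=> h; elim: r => [|i r [/andP[p0 p1] IH]].
  by rewrite !big_nil subrr ler01 !lexx.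
rewrite !big_cons; have /andP[x0 x1] := h i; split.
  by rewrite mulr_ge0 //= mulr_ile1.
by move: p0 p1 IH x0 x1; set p := \prod_(_ <- _) _; nra.
Qed.

(** The defects 1 - lambda_{k_i} add up, each is at most k_i^2 times a common
    factor, and the sum of the k_i^2 is at most d^2. The smallness hypothesis
    keeps the univariate eigenvalues nonnegative. *)
Lemma jackson_eigX_bounds (R : realType) n d M m (k : 'X_{1..n}) :
  (m.*2.+1 < M)%N -> (mdeg k <= d)%N ->
  d%:R ^+ 2 * (jackson_angle R m ^+ 2 / 2) <= 1 ->
  1 - d%:R ^+ 2 * (jackson_angle R m ^+ 2 / 2) <= jackson_eigX R M m k <= 1.
Proof.
move=> mM kd; set a := jackson_angle R m ^+ 2 / 2 => ha.
have a0 : 0 <= a by rewrite divr_ge0 // sqr_ge0.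
have le_a (b : nat) : (b <= d ^ 2)%N -> b%:R * a <= d%:R ^+ 2 * a.
  by move=> bd; rewrite ler_wpM2r // -natrX ler_nat.
have M0 : (0 < M)%N by apply: leq_trans mM.
have lam01 i : 0 <= jackson_eig R M m (k i) <= 1.
  rewrite jackson_eig_le1 // andbT -[X in 0 <= X](subKr 1) subr_ge0.
  apply: le_trans (one_sub_jackson_eig_le _ _ mM) _; rewrite -/a.
  apply: le_trans ha; rewrite -natrX le_a // leq_exp2r //.
  exact: leq_trans (leq_mnm_mdeg k i) kd.
have [/andP[_ ->] h] := one_sub_prod_le (index_enum 'I_n) lam01.
rewrite andbT lerBlDl -lerBlDr; apply: le_trans h _.
apply: (@le_trans _ _ (\sum_(i < n) ((k i) ^ 2)%:R * a)).
  by apply: ler_sum => i _; rewrite natrX one_sub_jackson_eig_le.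
rewrite -mulr_suml -natr_sum le_a //.
by apply: leq_trans (sum_sqr_mnm_le k) _; rewrite leq_exp2r.
Qed.

Lemma norm_chebX_le1 (R : realType) n (k : 'X_{1..n}) (x : 'I_n -> R) :
  box R n x -> `|(chebX R k).@[x]| <= 1.
Proof.
move=> xb; rewrite meval_chebX normr_prod; apply: prodr_ile1 => i _.
by rewrite normr_ge0 -[x i]acosK ?in_itv //= chebT_cos cos_max.
Qed.

(** The Chebyshev products are bounded by 1 on the box, so the sum of the
    absolute values of the coefficients is a bound. [inf] and [sup] bound the
    values of f only once these are known to be bounded. *)
Lemma box_bounded (R : realType) n (f : {mpoly R[n]}) :
  exists B, forall x, box R n x -> `|f.@[x]| <= B.
Proof.
have [c ->] := chebspan_msize (leqSpred (msize f)).
exists (\sum_(k : 'X_{1..n < (msize f).-1.+1}) `|c k|) => x xb.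
rewrite meval_cheb_sum; apply: le_trans (ler_norm_sum _ _ _) _.
by apply: ler_sum => k _; rewrite normrM ler_piMr // norm_chebX_le1.
Qed.

Lemma fmin_le (R : realType) n (f : {mpoly R[n]}) (x : 'I_n -> R) :
  box R n x -> fmin f <= f.@[x].
Proof.
move=> xb; have [B hB] := box_bounded f.
apply: ge_inf; last by exists x.
exists (- B) => _ [y yb <-].
by have := hB y yb; rewrite ler_norml => /andP[].
Qed.

Lemma le_fmax (R : realType) n (f : {mpoly R[n]}) (x : 'I_n -> R) :
  box R n x -> f.@[x] <= fmax f.
Proof.
move=> xb; have [B hB] := box_bounded f.
apply: ub_le_sup; last by exists x.
exists B => _ [y yb <-].
by have := hB y yb; rewrite ler_norml => /andP[].
Qed.

Lemma box0 (R : realType) n : box R n (fun=> 0).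
Proof. by move=> i; rewrite oppr_le0 ler01. Qed.

Lemma fmin_le_fmax (R : realType) n (f : {mpoly R[n]}) : fmin f <= fmax f.
Proof. exact: le_trans (fmin_le _ (@box0 R n)) (le_fmax _ (@box0 R n)). Qed.

Lemma cheb_sum_add_const (R : realType) n d (c : 'X_{1..n} -> R) (e : R) :
  cheb_sum d (fun k => c k + e * (k == 0%MM)%:R) = cheb_sum d c + e%:MP.
Proof.
rewrite /cheb_sum; under eq_bigr do rewrite scalerDl.
rewrite big_split /=; congr (_ + _).
have d0 : (mdeg (0%MM : 'X_{1..n}) < d.+1)%N by rewrite mdeg0.
rewrite (bigD1 (BMultinom d0)) //= eqxx mulr1 big1 ?addr0.
  by rewrite chebX0 -mul_mpolyC mulr1.
by move=> k; rewrite bmeqP /= => /negbTE ->; rewrite mulr0 scale0r.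
Qed.

Lemma lower_bound_ge (R : realType) n r (f : {mpoly R[n]}) (l : R) :
  preordering R n r (f - l%:MP) -> (l%:E <= lower_bound f r)%E.
Proof. by move=> h; apply: ereal_sup_ubound; exists l. Qed.

(** Here e bounds 1 / Lambda_k - 1, and e times the bracketed factor times
    fmax - fmin is the eps by which the lower bound falls short of fmin. *)
Lemma lower_bound_error (R : realType) n d r (f : {mpoly R[n]}) (e : R) :
  (mdegree f <= d)%N -> (0 < r)%N ->
  pi ^+ 2 * d%:R ^+ 2 / r%:R ^+ 2 <= e -> e <= 1 / 2 ->
  ((fmin f)%:E - lower_bound f ((r + 1) * n)
   <= (e * (#|{: 'X_{1..n < d.+1}}|%:R * Num.sqrt 2 ^+ minn n d)
       * (fmax f - fmin f))%:E)%E.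
Proof.
move=> fd r0 eE e12.
(* 2m is at most r + 1, to respect the degree bound, and at least r, for the
   rate; M exceeds the frequencies d + 2m and 2m + 1 met on the grid. *)
pose m := uphalf r; pose M := (m + d).+1.*2.
have m0 : (0 < m)%N by rewrite /m uphalf_gt0.
have mr : (r <= m.*2 <= r + 1)%N.
  by rewrite /m; have := uphalf_half r; have := odd_double_half r; lia.
set delta := fmax f - fmin f.
set N := _%:R * _.
pose eps := e * N * delta; rewrite -/eps.
have e0 : 0 <= e by rewrite (le_trans _ eE) // -exprMn -expr_div_n sqr_ge0.
have delta0 : 0 <= delta by rewrite subr_ge0 fmin_le_fmax.
suff pr : preordering R n ((r + 1) * n) (f - (fmin f - eps)%:MP).
  have -> : eps = fmin f - (fmin f - eps) by ring.
  by rewrite EFinB leeB // lower_bound_ge.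
have [c gc] : chebspan d (f - (fmin f)%:MP).
  apply: chebspan_msize; apply: msize_addl_le.
    by move: fd; rewrite /mdegree -subn1 leq_subLR add1n.
  by rewrite msizeN msizeC; case: (_ != _).
have cle (k : 'X_{1..n < d.+1}) : `|c k| <= Num.sqrt 2 ^+ minn n d * delta.
  have gb x : box R n x -> `|(cheb_sum d c).@[x]| <= delta.
    move=> xb; rewrite -gc mevalB mevalC ger0_norm ?subr_ge0 ?fmin_le //.
    by rewrite lerD2r le_fmax.
  apply: le_trans (cheb_coef_le gb k) _; rewrite ler_wpM2r //.
  rewrite ler_weXn2l ?ler_sqrt1 //.
    by rewrite -[X in X <= _]sqrtr1 ler_sqrt // ler1n.
  apply: leq_trans (nvars_le k) _.
  by rewrite leq_min geq_minl (leq_trans (geq_minr _ _)) // -ltnS bmdeg.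
pose L (k : 'X_{1..n}) := jackson_eigX R M m k.
have eta : d%:R ^+ 2 * (jackson_angle R m ^+ 2 / 2) <= e / 2.
  apply: (@le_trans _ _ (d%:R ^+ 2 * ((pi / r%:R) ^+ 2 / 2))); last first.
    suff -> : d%:R ^+ 2 * ((pi / r%:R) ^+ 2 / 2)
              = pi ^+ 2 * d%:R ^+ 2 / r%:R ^+ 2 / 2 :> R by rewrite ler_pM2r.
    by rewrite expr_div_n; ring.
  rewrite ler_wpM2l ?sqr_ge0 // ler_wpM2r ?invr_ge0 //.
  have p0 := pi_ge0 R.
  rewrite ler_pXn2r ?nnegrE ?divr_ge0 // ler_wpM2l // lef_pV2 ?posrE ?ltr0n //.
  by rewrite ler_nat doubleS; lia.
have Lk (k : 'X_{1..n < d.+1}) : 1 - e / 2 <= L k <= 1.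
  have kd : (mdeg k <= d)%N := bmdeg k.
  have eta1 : d%:R ^+ 2 * (jackson_angle R m ^+ 2 / 2) <= 1.
    by apply: le_trans eta _; lra.
  have mM : (m.*2.+1 < M)%N by rewrite /M; lia.
  have /andP[h h1] := jackson_eigX_bounds mM kd eta1.
  by rewrite /L h1 andbT (le_trans _ h) // lerD2l lerN2.
pose c' k := c k / L k.
have pos x : box R n x ->
    0 <= (cheb_sum d (fun k => c' k + eps * (k == 0%MM)%:R)).@[x].
  move=> xb; rewrite cheb_sum_add_const mevalD mevalC.
  have -> : (cheb_sum d c').@[x] = (cheb_sum d c).@[x]
      + \sum_(k : 'X_{1..n < d.+1}) (c' k - c k) * (chebX R k).@[x].
    rewrite !meval_cheb_sum -big_split; apply: eq_bigr => k _ /=; ring.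
  rewrite -addrA addr_ge0 //.
    by rewrite -gc mevalB mevalC subr_ge0 fmin_le.
  rewrite -[X in _ + X]opprK subr_ge0 lerNl; apply: le_trans (ler_norm _) _.
  rewrite normrN; apply: le_trans (ler_norm_sum _ _ _) _.
  pose S := Num.sqrt 2 ^+ minn n d * delta.
  apply: (@le_trans _ _ (\sum_(k : 'X_{1..n < d.+1}) e * S)).
    apply: ler_sum => k _; rewrite normrM.
    rewrite -[X in _ <= X]mulr1 ler_pM // ?norm_chebX_le1 //.
    have /andP[l0 l1] := Lk k; have lp : 0 < L k by lra.
    have -> : c' k - c k = (L k)^-1 * (1 - L k) * c k.
      by rewrite /c'; field; rewrite gt_eqF.
    rewrite normrM ler_pM // ?cle // ger0_norm; last first.
      by rewrite mulr_ge0 ?invr_ge0 ?subr_ge0 // ltW.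
    (* with t = 1 - L k <= e / 2 <= 1 / 4, t <= (1 - t) e *)
    rewrite mulrC ler_pdivrMr //; nra.
  suff -> : \sum_(k : 'X_{1..n < d.+1}) e * S = eps by [].
  by rewrite sumr_const -[LHS]mulr_natl /eps /N /S; ring.
have dmM : (d + m.*2 < M)%N by rewrite /M; lia.
have := jackson_preordering m0 dmM pos.
have -> : cheb_sum d (fun k => jackson_eigX R M m k
                               * (c' k + eps * (k == 0%MM)%:R))
          = f - (fmin f - eps)%:MP.
  transitivity (cheb_sum d (fun k => c k + eps * (k == 0%MM)%:R)).
    apply: eq_bigr => k _; congr (_ *: _).
    have /andP[l0 l1] := Lk k; have lp : 0 < L k by lra.
    rewrite mulrDr -/(L k) /c' [X in X + _]mulrC divfK ?(gt_eqF lp) //.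
    congr (_ + _).
    have [->|] := eqVneq (k : 'X_{1..n}) 0%MM; last by rewrite !mulr0.
    rewrite /L /jackson_eigX big1 ?mul1r // => i _.
    by rewrite mnmE jackson_eig0.
  by rewrite cheb_sum_add_const -gc mpolyCB opprB addrA addrAC.
apply: preordering_le; rewrite leq_mul2r; apply/orP; right.
by case/andP: mr.
Qed.
(** The condition on r gives pi^2 d^2 / r^2 <= 1 / (2 n) <= 1 / 2, which is
    what [lower_bound_error] requires. *)
Lemma rate_constant_intro (R : realType) n d (C : R) :
  (1 <= n)%N -> 0 < C ->
  pi ^+ 2 * d%:R ^+ 2
    * (#|{: 'X_{1..n < d.+1}}|%:R * Num.sqrt 2 ^+ minn n d) <= C ->
  rate_constant n d C.
Proof.
move=> n1 C0 hC; split=> // f fd r r1 hr.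
have r0 : 0 < r%:R :> R by rewrite ltr0n.
have p0 := pi_ge0 R.
pose e : R := pi ^+ 2 * d%:R ^+ 2 / r%:R ^+ 2.
have e12 : e <= 1 / 2.
  rewrite /e ler_pdivrMr ?exprn_gt0 //.
  have : (pi * d%:R * Num.sqrt (2 * n%:R)) ^+ 2 <= r%:R ^+ 2 :> R.
    by rewrite ler_pXn2r ?nnegrE ?mulr_ge0 ?sqrtr_ge0.
  rewrite exprMn sqr_sqrtr ?mulr_ge0 // exprMn.
  have : (1 : R) <= n%:R by rewrite ler1n.
  set N : R := n%:R; have : 0 <= pi ^+ 2 * d%:R ^+ 2 :> R.
    by rewrite mulr_ge0 ?sqr_ge0.
  by set x := pi ^+ 2 * _; nra.
apply: le_trans (lower_bound_error (eq_leq fd) r1 (lexx e) e12) _.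
rewrite lee_fin ler_wpM2r ?subr_ge0 ?fmin_le_fmax //.
by rewrite mulrAC ler_wpM2r ?invr_ge0 ?exprn_ge0.
Qed.

Lemma sqrt2_expn (R : realType) k : Num.sqrt 2 ^+ k = powR 2 (k%:R / 2) :> R.
Proof.
by rewrite mulrC powRrM powR12_sqrt // powR_mulrn // sqrtr_ge0.
Qed.

Lemma sqrt2_expn_le (R : realType) k l : (k <= l)%N ->
  Num.sqrt 2 ^+ k <= powR 2 (l%:R / 2) :> R.
Proof.
move=> kl; rewrite -sqrt2_expn ler_weXn2l //.
by rewrite -[X in X <= _]sqrtr1 ler_sqrt // ler1n.
Qed.

(** The degree 0 case is separate because the formula vanishes there, whereas
    a rate constant is positive. *)
Definition rateC (R : realType) (n d : nat) (K L : R) : R :=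
  if d == 0%N then 1 else 2 * pi ^+ 2 * d%:R ^+ 2 * n%:R * K * L.

Lemma rateC_le (R : realType) n d (K L : R) :
  0 <= K -> 0 <= L ->
  rateC n d K L <= 1 + 2 * pi ^+ 2 * d%:R ^+ 2 * n%:R * K * L.
Proof.
move=> K0 L0; have p0 := pi_ge0 R; rewrite /rateC.
case: eqP => _; last by rewrite lerDr.
by rewrite lerDl !mulr_ge0 ?exprn_ge0.
Qed.

Lemma rate_constant_rateC (R : realType) n d (K L : R) :
  (1 <= n)%N -> 0 < K -> 0 < L ->
  Num.sqrt 2 ^+ minn n d <= K -> #|{: 'X_{1..n < d.+1}}|%:R <= L ->
  rate_constant n d (rateC n d K L).
Proof.
move=> n1 K0 L0 hK hL; have p0 := pi_gt0 R; rewrite /rateC.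
case: eqP => [->|/eqP d0]; apply: rate_constant_intro => //.
- by rewrite expr0n mulr0 mul0r.
- by rewrite !mulr_gt0 ?exprn_gt0 ?ltr0n // lt0n.
apply: (@le_trans _ _ (pi ^+ 2 * d%:R ^+ 2 * (L * K))).
  apply: ler_wpM2l; first by rewrite mulr_ge0 ?sqr_ge0.
  by apply: ler_pM => //; rewrite exprn_ge0 // sqrtr_ge0.
have n1' : (1 : R) <= n%:R by rewrite ler1n.
have -> : 2 * pi ^+ 2 * d%:R ^+ 2 * n%:R * K * L
        = 2 * n%:R * (pi ^+ 2 * d%:R ^+ 2 * (L * K)) :> R by ring.
by rewrite ler_peMl ?mulr_ge0 ?sqr_ge0 // ?(ltW K0) ?(ltW L0) //; lra.
Qed.

Theorem theorem2 (R : realType) :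
  [/\ forall n d : nat, (1 <= n)%N -> exists C : R, rate_constant n d C,
      exists C : nat -> nat -> R,
        [/\ forall n d : nat, (1 <= n)%N -> rate_constant n d (C n d),
            forall d : nat, exists p : {poly R},
              forall n : nat, (1 <= n)%N -> C n d <= p.[n%:R]
          & forall n d : nat, (1 <= n)%N -> (1 <= d)%N ->
              C n d <= 2 * pi ^+ 2 * d%:R ^+ 2 * n%:R
                       * powR 2 (d%:R / 2) * (n%:R + 1) ^+ d]
    & exists C : nat -> nat -> R,
        [/\ forall n d : nat, (1 <= n)%N -> rate_constant n d (C n d),
            forall n : nat, (1 <= n)%N -> exists p : {poly R},
              forall d : nat, C n d <= p.[d%:R]
          & forall n d : nat, (1 <= n)%N -> (1 <= d)%N ->
              C n d <= 2 * pi ^+ 2 * d%:R ^+ 2 * n%:R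
                       * powR 2 (n%:R / 2) * (d%:R + 1) ^+ n]].
Proof.
have pow0 k : 0 < powR 2 (k%:R / 2) :> R by rewrite powR_gt0.
have succ0 k l : 0 < (k%:R + 1) ^+ l :> R by rewrite natr1 exprn_gt0.
pose C1 n d : R := rateC n d (powR 2 (d%:R / 2)) ((n%:R + 1) ^+ d).
pose C2 n d : R := rateC n d (powR 2 (n%:R / 2)) ((d%:R + 1) ^+ n).
have C1P n d : (1 <= n)%N -> rate_constant n d (C1 n d).
  move=> n1; apply: rate_constant_rateC => //.
    by rewrite sqrt2_expn_le // geq_minr.
  by rewrite natr1 -natrX ler_nat card_bmultinom_expS.
have C2P n d : (1 <= n)%N -> rate_constant n d (C2 n d).
  move=> n1; apply: rate_constant_rateC => //.
    by rewrite sqrt2_expn_le // geq_minl.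
  by rewrite natr1 -natrX ler_nat card_bmultinom_expn.
split.
- by move=> n d n1; exists (C1 n d); apply: C1P.
- exists C1; split=> // [d|n d _ d1]; last by rewrite /C1 /rateC gtn_eqF.
  exists (1%:P + (2 * pi ^+ 2 * d%:R ^+ 2 * powR 2 (d%:R / 2))
                 *: ('X * ('X + 1%:P) ^+ d)).
  move=> n _; apply: le_trans (rateC_le _ _ (ltW (pow0 _)) (ltW (succ0 _ _))) _.
  by rewrite le_eqVlt; apply/orP; left; apply/eqP;
  rewrite !(hornerD, hornerZ, hornerM, horner_exp, hornerX, hornerC); ring.
exists C2; split=> // [n _|n d _ d1]; last by rewrite /C2 /rateC gtn_eqF.
exists (1%:P + (2 * pi ^+ 2 * n%:R * powR 2 (n%:R / 2))
               *: ('X ^+ 2 * ('X + 1%:P) ^+ n)).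
move=> d; apply: le_trans (rateC_le _ _ (ltW (pow0 _)) (ltW (succ0 _ _))) _.
by rewrite le_eqVlt; apply/orP; left; apply/eqP;
  rewrite !(hornerD, hornerZ, hornerM, horner_exp, hornerX, hornerC); ring.
Qed.
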